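(* Let $\omega\in\mathbb{R}$, $\omega\neq 0$, and $\kappa_1^h,\kappa_2^h\in\mathcal{K}$, and let $e^{-\iota\omega t}\prod_{\alpha=1}^2 e^{\iota\kappa_\alpha^h i_\alpha h}$, $\mathbf{i}=(i_1,i_2)\in\mathbb{Z}^2$, be a discrete traveling wave that satisfies the discrete wave equation $\partial_t^2 u_{\mathbf{i}}(t)=\mathcal{L}_h u_{\mathbf{i}}(t)$, $\mathbf{i}\in\mathbb{Z}^2$. Then the extension of this wave in the PML domain, which is given by $$u_{\mathbf{i}}(t)=e^{-\iota\omega t}\prod_{\alpha=1}^2\eta(i_\alpha,\sigma^\alpha,\kappa_\alpha^h,\omega)\,e^{\iota\kappa_\alpha^h i_\alpha h}\quad\text{with}\quad \eta(i_\alpha,\sigma^\alpha,\kappa_\alpha^h,\omega)=\prod_{l=0}^{i_\alpha-1}\frac{2+\iota\frac{\sigma^\alpha_l}{\omega}(1-e^{-\iota\kappa_\alpha^h h})}{2+\iota\frac{\sigma^\alpha_l}{\omega}(1-e^{\iota\kappa_\alpha^h h})},$$ is the solution of the discrete PML equations (P0)–(P6) written out in the context (that is, together with accompanying auxiliary variables $\tilde\psi^{\alpha,k}_{\mathbf{i}},\bar\psi^{\alpha,k}_{\mathbf{i}}$ for $\alpha=1,2$, $k\in\mathbb{Z}^+$, and $\tilde{\tilde\psi}^{\mathbf{k}}_{\mathbf{i}},\tilde{\bar\psi}^{\mathbf{k}}_{\mathbf{i}},\bar{\tilde\psi}^{\mathbf{k}}_{\mathbf{i}},\bar{\bar\psi}^{\mathbf{k}}_{\mathbf{i}}$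 for $\mathbf{k}\in(\mathbb{Z}^+)^2$, it satisfies (P0)–(P6)).
   Context: $\iota$ is the imaginary unit, $\mathbb{Z}^+=\{1,2,\dots\}$, $h>0$ is the mesh size, and $$\mathcal{K}=\{\kappa\in\mathbb{C}:\ -\tfrac{\pi}{h}<\Re\kappa\le\tfrac{\pi}{h},\ \Im\kappa<0\}.$$ Discrete nonlocal operator. Let $\delta>0$, let $\mathcal{H}_{\mathbf{0}}\subset\mathbb{R}^2$ be the disc of radius $\delta$ centered at $\mathbf 0$, and let $\gamma$ be a nonnegative radial kernel, $\gamma(\mathbf{z})=\gamma(|\mathbf{z}|)$. Put $\mathbf{x}_{\mathbf{k}}=h\mathbf{k}$, $W(\mathbf{z})=|\mathbf{z}|^2/|\mathbf{z}|_1$ ($|\cdot|$ Euclidean norm, $|\cdot|_1$ the $\ell^1$ norm), and let $\phi_{\mathbf{k}}$ be the piecewise bilinear basis function on the uniform grid $h\mathbb{Z}^2$ ($\phi_{\mathbf{k}}(\mathbf{x}_{\mathbf{k}})=1$, $\phi_{\mathbf{k}}(\mathbf{x}_{\mathbf{i}})=0$ for $\mathbf{i}\ne\mathbf{k}$). Define $$a_{\mathbf{k}}=\frac{1}{W(\mathbf{x}_{\mathbf{k}})}\int_{\mathcal{H}_{\mathbf 0}}\phi_{\mathbf{k}}(\mathbf{z})W(\mathbf{z})\gamma(\mathbf{z})\,d\mathbf{z}\ (\mathbf{k}\neq\mathbf 0),\qquad a_{\mathbf 0}=-\sum_{\mathbf{k}\ne\mathbf 0}a_{\mathbf{k}},\qquad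 \mathcal{L}_hu_{\mathbf{i}}=\sum_{\mathbf{k}\in\mathbb{Z}^2}a_{\mathbf{k}}u_{\mathbf{i}+\mathbf{k}}.$$ One has $a_{(k_1,k_2)}=a_{(\pm k_1,\pm k_2)}$, and $a_{(k,0)}=a_{(0,k)}=:a_k$ for $k\in\mathbb{Z}^+$. Damping. For $\alpha=1,2$, $(\sigma^\alpha_l)_{l\in\mathbb{Z}}$ are the PML damping coefficients, real numbers with $\sigma_l^\alpha\ge 0$ for all $l$ and $\sigma_l^\alpha=0$ for $l<0$; write $\sigma^\alpha_{\mathbf{i}}=\sigma^\alpha_{i_\alpha}$. An empty product (for $i_\alpha\le 0$) equals $1$. Translations: $\tau^1_kv_{\mathbf{i}}=v_{(i_1+k,i_2)}$, $\tau^2_kv_{\mathbf{i}}=v_{(i_1,i_2+k)}$; a translation applied to a product shifts all factors. The PML domain is $\{i_1\ge0\}\cup\{i_2\ge0\}\subset\mathbb{Z}^2$. In sums ''$\alpha\ne\beta$'' runs over $(\alpha,\beta)\in\{(1,2),(2,1)\}$. Discrete PML equations. (P0) is imposed for $\mathbf{i}$ in the PML domain. The auxiliary variables $\tilde\psi^{\alpha,k}_{\mathbf i},\bar\psi^{\alpha,k}_{\mathbf i}$ and their equations (P1),(P2) only need to be supported in $\{i_\alpha\ge0\}$; the variables $\tilde{\tilde\psi}^{\mathbf k}_{\mathbf i},\tilde{\bar\psi}^{\mathbf k}_{\mathbf i},\bar{\tilde\psi}^{\mathbf k}_{\mathbf i},\bar{\bar\psi}^{\mathbf k}_{\mathbf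 i}$ and their equations (P3)–(P6) only need to be supported in $\{i_1\ge0\}\cap\{i_2\ge0\}$. The variables are set to zero outside these sets. (P0) $$\begin{aligned}\partial_t^2u_{\mathbf i}=\ &\mathcal{L}_hu_{\mathbf i}+h\sum_{\alpha=1}^2\sum_{k\in\mathbb{Z}^+}\sum_{l=0}^{k-1}a_k\Big(\tau^\alpha_l(\sigma^\alpha_{\mathbf i}\tilde\psi^{\alpha,k-l}_{\mathbf i})-\tau^\alpha_{-l-1}(\sigma^\alpha_{\mathbf i}\bar\psi^{\alpha,k-l}_{\mathbf i})\Big)\\ &+h\sum_{\alpha\ne\beta}\sum_{\mathbf k\in(\mathbb{Z}^+)^2}\sum_{l=0}^{k_\alpha-1}a_{\mathbf k}(\tau^\beta_{-k_\beta}+\tau^\beta_{k_\beta})\Big(\tau^\alpha_l(\sigma^\alpha_{\mathbf i}\tilde\psi^{\alpha,k_\alpha-l}_{\mathbf i})-\tau^\alpha_{-l-1}(\sigma^\alpha_{\mathbf i}\bar\psi^{\alpha,k_\alpha-l}_{\mathbf i})\Big)\\ &+h^2\sum_{\mathbf k\in(\mathbb{Z}^+)^2}\ \sum_{l=0}^{k_1-1}\sum_{m=0}^{k_2-1}a_{\mathbf k}\Big[\tau^1_l\tau^2_m(\sigma^1_{\mathbf i}\sigma^2_{\mathbf i}\tilde{\tilde\psi}^{k_1-l,k_2-m}_{\mathbf i})-\tau^1_{-l-1}\tau^2_m(\sigma^1_{\mathbf i}\sigma^2_{\mathbf i}\tilde{\bar\psi}^{k_1-l,k_2-m}_{\mathbf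 i})\\ &\qquad-\tau^1_l\tau^2_{-m-1}(\sigma^1_{\mathbf i}\sigma^2_{\mathbf i}\bar{\tilde\psi}^{k_1-l,k_2-m}_{\mathbf i})+\tau^1_{-l-1}\tau^2_{-m-1}(\sigma^1_{\mathbf i}\sigma^2_{\mathbf i}\bar{\bar\psi}^{k_1-l,k_2-m}_{\mathbf i})\Big].\end{aligned}$$ (P1) $\displaystyle \partial_t\tilde\psi^{\alpha,k}_{\mathbf i}=\frac{(\tau^\alpha_{k-1}-\tau^\alpha_{k+1})u_{\mathbf i}}{2h}-\frac{(\tau^\alpha_1+\tau^\alpha_0)(\sigma^\alpha_{\mathbf i}\tilde\psi^{\alpha,k}_{\mathbf i})}{2}-\sum_{l=1}^{k-1}\frac{(\tau^\alpha_{l+1}-\tau^\alpha_{l-1})(\sigma^\alpha_{\mathbf i}\tilde\psi^{\alpha,k-l}_{\mathbf i})}{2}.$ (P2) $\displaystyle \partial_t\bar\psi^{\alpha,k}_{\mathbf i}=\frac{(\tau^\alpha_{-k}-\tau^\alpha_{-k+2})u_{\mathbf i}}{2h}-\frac{(\tau^\alpha_0+\tau^\alpha_{-1})(\sigma^\alpha_{\mathbf i}\bar\psi^{\alpha,k}_{\mathbf i})}{2}-\sum_{l=1}^{k-1}\frac{(\tau^\alpha_{-l-1}-\tau^\alpha_{-l+1})(\sigma^\alpha_{\mathbf i}\bar\psi^{\alpha,k-l}_{\mathbf i})}{2}.$ (P3) $\displaystyle \partial_t\tilde{\tilde\psi}^{\mathbf k}_{\mathbf i}=\frac{(\tau^1_{k_1-1}-\tau^1_{k_1+1})\tilde\psi^{2,k_2}_{\mathbf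 i}}{2h}-\frac{(\tau^1_1+\tau^1_0)(\sigma^1_{\mathbf i}\tilde{\tilde\psi}^{\mathbf k}_{\mathbf i})}{2}-\sum_{l=1}^{k_1-1}\frac{(\tau^1_{l+1}-\tau^1_{l-1})(\sigma^1_{\mathbf i}\tilde{\tilde\psi}^{k_1-l,k_2}_{\mathbf i})}{2}.$ (P4) $\displaystyle \partial_t\tilde{\bar\psi}^{\mathbf k}_{\mathbf i}=\frac{(\tau^1_{-k_1}-\tau^1_{-k_1+2})\tilde\psi^{2,k_2}_{\mathbf i}}{2h}-\frac{(\tau^1_0+\tau^1_{-1})(\sigma^1_{\mathbf i}\tilde{\bar\psi}^{\mathbf k}_{\mathbf i})}{2}-\sum_{l=1}^{k_1-1}\frac{(\tau^1_{-l-1}-\tau^1_{-l+1})(\sigma^1_{\mathbf i}\tilde{\bar\psi}^{k_1-l,k_2}_{\mathbf i})}{2}.$ (P5) $\displaystyle \partial_t\bar{\tilde\psi}^{\mathbf k}_{\mathbf i}=\frac{(\tau^1_{k_1-1}-\tau^1_{k_1+1})\bar\psi^{2,k_2}_{\mathbf i}}{2h}-\frac{(\tau^1_1+\tau^1_0)(\sigma^1_{\mathbf i}\bar{\tilde\psi}^{\mathbf k}_{\mathbf i})}{2}-\sum_{l=1}^{k_1-1}\frac{(\tau^1_{l+1}-\tau^1_{l-1})(\sigma^1_{\mathbf i}\bar{\tilde\psi}^{k_1-l,k_2}_{\mathbf i})}{2}.$ (P6) $\displaystyle \partial_t\bar{\bar\psi}^{\mathbf k}_{\mathbf i}=\frac{(\tau^1_{-k_1}-\tau^1_{-k_1+2})\bar\psi^{2,k_2}_{\mathbf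 i}}{2h}-\frac{(\tau^1_0+\tau^1_{-1})(\sigma^1_{\mathbf i}\bar{\bar\psi}^{\mathbf k}_{\mathbf i})}{2}-\sum_{l=1}^{k_1-1}\frac{(\tau^1_{-l-1}-\tau^1_{-l+1})(\sigma^1_{\mathbf i}\bar{\bar\psi}^{k_1-l,k_2}_{\mathbf i})}{2}.$ *)

(* Defs.v *)
From HB Require Import structures.
From mathcomp Require Import all_boot all_order all_algebra.
From mathcomp Require Import complex.
From mathcomp Require Import all_classical all_reals all_analysis.

Set Implicit Arguments.
Unset Strict Implicit.
Unset Printing Implicit Defensive.

Import Order.TTheory GRing.Theory Num.Theory.
Import numFieldNormedType.Exports.

Local Open Scope classical_set_scope.
Local Open Scope complex_scope.
Local Open Scope ring_scope.

Definition cexp (R : realType) (z : R[i]) : R[i] :=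
  (expR (complex.Re z))%:C * (cos (complex.Im z) +i* sin (complex.Im z)).

(* f' is the derivative of f at every time; R[i] carries no normed-space
   structure over R, so the derivative is taken on real and imaginary parts. *)
Definition has_dt (R : realType) (f f' : R -> R[i]) : Prop :=
  forall t : R,
    is_derive t (1 : R) (fun s => complex.Re (f s)) (complex.Re (f' t)) /\
    is_derive t (1 : R) (fun s => complex.Im (f s)) (complex.Im (f' t)).

Definition has_dtt (R : realType) (f f'' : R -> R[i]) : Prop :=
  exists2 f' : R -> R[i], has_dt f f' & has_dt f' f''.

(* The axes 1 and 2 are the two elements of 'I_2. *)

Definition ax1 : 'I_2 := ord0.
Definition ax2 : 'I_2 := ord_max.

Definition axcoord (T : Type) (p : T * T) (al : 'I_2) : T :=
  if al == ax1 then p.1 else p.2.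

Definition lattice : Type := (int * int)%type.

Definition gridfun (R : realType) : Type := lattice -> R[i].

Definition translate (al : 'I_2) (k : int) (i : lattice) : lattice :=
  if al == ax1 then (i.1 + k, i.2) else (i.1, i.2 + k).

Definition tau (R : realType) (al : 'I_2) (k : int) (v : gridfun R) : gridfun R :=
  fun i => v (translate al k i).

Definition enorm (R : realType) (z : R * R) : R :=
  Num.sqrt (z.1 ^+ 2 + z.2 ^+ 2).

Definition disc (R : realType) (delta : R) : set (R * R) :=
  [set z | enorm z <= delta].

Definition grid (R : realType) (h : R) (k : lattice) : R * R :=
  (h * k.1%:~R, h * k.2%:~R).

Definition weight (R : realType) (z : R * R) : R :=
  enorm z ^+ 2 / (`|z.1| + `|z.2|).

(* The nodal bilinear basis function is the product of two 1D hat functions. *)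
Definition hat (R : realType) (h : R) (n : int) (x : R) : R :=
  Num.max 0 (1 - `|x / h - n%:~R|).

Definition phi (R : realType) (h : R) (k : lattice) (z : R * R) : R :=
  hat h k.1 z.1 * hat h k.2 z.2.

Definition leb2 (R : realType) :=
  ((@lebesgue_measure R) \x (@lebesgue_measure R))%E.
Arguments leb2 : clear implicits.

(* gamma is the profile r |-> gamma(r) of the radial kernel. *)
Definition coef_integrand (R : realType) (h : R) (gamma : R -> R)
    (k : lattice) (z : R * R) : R :=
  phi h k z * weight z * gamma (enorm z).

Definition coef_offdiag (R : realType) (h delta : R) (gamma : R -> R)
    (k : lattice) : R :=
  (weight (grid h k))^-1 *
  \int[leb2 R]_(z in disc delta) coef_integrand h gamma k z.

(* Sums over infinite index sets are the finitely supported sums of fsbigop: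
   coef_offdiag k = 0 as soon as the support of phi_k misses the disc. *)
Definition coef (R : realType) (h delta : R) (gamma : R -> R)
    (k : lattice) : R :=
  if k == (0, 0) then
    - \sum_(j \in [set j : lattice | j != (0, 0)]) coef_offdiag h delta gamma j
  else coef_offdiag h delta gamma k.

Definition nonlocal_op (R : realType) (h delta : R) (gamma : R -> R)
    (u : gridfun R) (i : lattice) : R[i] :=
  \sum_(k \in [set: lattice])
    (coef h delta gamma k)%:C * u (i.1 + k.1, i.2 + k.2).

Definition in_K (R : realType) (h : R) (kap : R[i]) : Prop :=
  [/\ - (pi / h) < complex.Re kap, complex.Re kap <= pi / h & complex.Im kap < 0].

Definition traveling_wave (R : realType) (h omega : R) (kappa : 'I_2 -> R[i])
    (t : R) (i : lattice) : R[i] :=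
  cexp (- 'i%C * omega%:C * t%:C) *
  \prod_(al < 2) cexp ('i%C * kappa al * (axcoord i al)%:~R * h%:C).

Definition eta_num (R : realType) (h omega s : R) (kap : R[i]) : R[i] :=
  2 + 'i%C * (s / omega)%:C * (1 - cexp (- 'i%C * kap * h%:C)).

Definition eta_den (R : realType) (h omega s : R) (kap : R[i]) : R[i] :=
  2 + 'i%C * (s / omega)%:C * (1 - cexp ('i%C * kap * h%:C)).

Definition eta (R : realType) (h : R) (j : int) (s : int -> R) (kap : R[i])
    (omega : R) : R[i] :=
  match j with
  | Posz n => \prod_(0 <= l < n)
                (eta_num h omega (s l%:Z) kap / eta_den h omega (s l%:Z) kap)
  | Negz _ => 1
  end.

Definition pml_wave (R : realType) (h omega : R) (sigma : 'I_2 -> int -> R)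
    (kappa : 'I_2 -> R[i]) (t : R) (i : lattice) : R[i] :=
  cexp (- 'i%C * omega%:C * t%:C) *
  \prod_(al < 2)
    (eta h (axcoord i al) (sigma al) (kappa al) omega *
     cexp ('i%C * kappa al * (axcoord i al)%:~R * h%:C)).

Definition damp (R : realType) (sigma : 'I_2 -> int -> R) (al : 'I_2)
    (v : gridfun R) : gridfun R :=
  fun i => (sigma al (axcoord i al))%:C * v i.

(* Common right-hand side of the equations for the tilde variable (w = u) and
   for the two corner variables with a tilde along axis 1 (al = 1 and
   w = psi~^{2,k_2} or psi-^{2,k_2}).  [psi m] is the unknown with upper
   index m along the axis al. *)
Definition rhs_tilde (R : realType) (h : R) (sigma : 'I_2 -> int -> R)
    (al : 'I_2) (k : nat) (w : gridfun R) (psi : nat -> gridfun R)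
    (i : lattice) : R[i] :=
  (tau al (k%:Z - 1) w i - tau al (k%:Z + 1) w i) / (2 * h%:C)
  - (tau al 1 (damp sigma al (psi k)) i
     + tau al 0 (damp sigma al (psi k)) i) / 2
  - \sum_(1 <= l < k)
      (tau al (l%:Z + 1) (damp sigma al (psi (k - l)%N)) i
       - tau al (l%:Z - 1) (damp sigma al (psi (k - l)%N)) i) / 2.

(* The same with a bar in place of the tilde along al. *)
Definition rhs_bar (R : realType) (h : R) (sigma : 'I_2 -> int -> R)
    (al : 'I_2) (k : nat) (w : gridfun R) (psi : nat -> gridfun R)
    (i : lattice) : R[i] :=
  (tau al (- k%:Z) w i - tau al (- k%:Z + 2) w i) / (2 * h%:C)
  - (tau al 0 (damp sigma al (psi k)) i
     + tau al (- 1) (damp sigma al (psi k)) i) / 2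
  - \sum_(1 <= l < k)
      (tau al (- l%:Z - 1) (damp sigma al (psi (k - l)%N)) i
       - tau al (- l%:Z + 1) (damp sigma al (psi (k - l)%N)) i) / 2.

Definition posN : set nat := [set k | (0 < k)%N].

Definition posN2 : set (nat * nat) := [set k | (0 < k.1)%N && (0 < k.2)%N].

(* tau^al_l (sigma^al psi~^{k-l}) - tau^al_{-l-1} (sigma^al psi-^{k-l}) *)
Definition layer (R : realType) (sigma : 'I_2 -> int -> R) (al : 'I_2)
    (psit psib : nat -> gridfun R) (k l : nat) : gridfun R :=
  tau al l%:Z (damp sigma al (psit (k - l)%N))
  \- tau al (- l%:Z - 1) (damp sigma al (psib (k - l)%N)).

Definition damp12 (R : realType) (sigma : 'I_2 -> int -> R)
    (v : gridfun R) : gridfun R :=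
  fun i => (sigma ax1 i.1)%:C * (sigma ax2 i.2)%:C * v i.

Definition rhs_wave (R : realType) (h delta : R) (gamma : R -> R)
    (sigma : 'I_2 -> int -> R) (u : gridfun R)
    (psit psib : 'I_2 -> nat -> gridfun R)
    (psitt psitb psibt psibb : nat * nat -> gridfun R) (i : lattice) : R[i] :=
  nonlocal_op h delta gamma u i
  + h%:C * (\sum_(al < 2) \sum_(k \in posN) \sum_(0 <= l < k)
      (coef h delta gamma (k%:Z, 0))%:C
      * layer sigma al (psit al) (psib al) k l i)
  + h%:C * (\sum_(al < 2) \sum_(be < 2 | al != be)
      \sum_(k \in posN2) \sum_(0 <= l < axcoord k al)
      (coef h delta gamma (k.1%:Z, k.2%:Z))%:C
      * (tau be (- (axcoord k be)%:Z)
           (layer sigma al (psit al) (psib al) (axcoord k al) l) i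
         + tau be (axcoord k be)%:Z
           (layer sigma al (psit al) (psib al) (axcoord k al) l) i))
  + h%:C ^+ 2 * (\sum_(k \in posN2) \sum_(0 <= l < k.1) \sum_(0 <= m < k.2)
      (coef h delta gamma (k.1%:Z, k.2%:Z))%:C
      * (let kk := ((k.1 - l)%N, (k.2 - m)%N) in
         tau ax1 l%:Z (tau ax2 m%:Z (damp12 sigma (psitt kk))) i
         - tau ax1 (- l%:Z - 1) (tau ax2 m%:Z (damp12 sigma (psitb kk))) i
         - tau ax1 l%:Z (tau ax2 (- m%:Z - 1) (damp12 sigma (psibt kk))) i
         + tau ax1 (- l%:Z - 1)
             (tau ax2 (- m%:Z - 1) (damp12 sigma (psibb kk))) i)).

(* The two-letter suffixes follow the notation of the equations: t is a tilde,
   b a bar, and the first letter is the upper accent (psitb is "tilde over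
   bar").  With this convention psitt, psitb are driven by psit ax2 and psibt,
   psibb by psib ax2; the second letter refers to axis 1. *)
Record pml_solution (R : realType) (h delta : R) (gamma : R -> R)
    (sigma : 'I_2 -> int -> R) (u : R -> gridfun R)
    (psit psib : 'I_2 -> nat -> R -> gridfun R)
    (psitt psitb psibt psibb : nat * nat -> R -> gridfun R) : Prop :=
  PmlSolution {
  pml_P0 : forall i : lattice, (0 <= i.1) || (0 <= i.2) ->
    has_dtt (fun t => u t i)
      (fun t => rhs_wave h delta gamma sigma (u t)
        (fun al k => psit al k t) (fun al k => psib al k t)
        (psitt^~ t) (psitb^~ t) (psibt^~ t) (psibb^~ t) i);
  pml_P1 : forall (al : 'I_2) (k : nat) (i : lattice),
    (0 < k)%N -> 0 <= axcoord i al ->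
    has_dt (fun t => psit al k t i)
      (fun t => rhs_tilde h sigma al k (u t) (fun m => psit al m t) i);
  pml_P2 : forall (al : 'I_2) (k : nat) (i : lattice),
    (0 < k)%N -> 0 <= axcoord i al ->
    has_dt (fun t => psib al k t i)
      (fun t => rhs_bar h sigma al k (u t) (fun m => psib al m t) i);
  pml_P3 : forall (k : nat * nat) (i : lattice),
    (0 < k.1)%N -> (0 < k.2)%N -> 0 <= i.1 -> 0 <= i.2 ->
    has_dt (fun t => psitt k t i)
      (fun t => rhs_tilde h sigma ax1 k.1 (psit ax2 k.2 t)
        (fun m => psitt (m, k.2) t) i);
  pml_P4 : forall (k : nat * nat) (i : lattice),
    (0 < k.1)%N -> (0 < k.2)%N -> 0 <= i.1 -> 0 <= i.2 ->
    has_dt (fun t => psitb k t i)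
      (fun t => rhs_bar h sigma ax1 k.1 (psit ax2 k.2 t)
        (fun m => psitb (m, k.2) t) i);
  pml_P5 : forall (k : nat * nat) (i : lattice),
    (0 < k.1)%N -> (0 < k.2)%N -> 0 <= i.1 -> 0 <= i.2 ->
    has_dt (fun t => psibt k t i)
      (fun t => rhs_tilde h sigma ax1 k.1 (psib ax2 k.2 t)
        (fun m => psibt (m, k.2) t) i);
  pml_P6 : forall (k : nat * nat) (i : lattice),
    (0 < k.1)%N -> (0 < k.2)%N -> 0 <= i.1 -> 0 <= i.2 ->
    has_dt (fun t => psibb k t i)
      (fun t => rhs_bar h sigma ax1 k.1 (psib ax2 k.2 t)
        (fun m => psibb (m, k.2) t) i);
  pml_supp1 : forall (al : 'I_2) (k : nat) (t : R) (i : lattice),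
    (0 < k)%N -> axcoord i al < 0 -> psit al k t i = 0 /\ psib al k t i = 0;
  pml_supp2 : forall (k : nat * nat) (t : R) (i : lattice),
    (0 < k.1)%N -> (0 < k.2)%N -> (i.1 < 0) || (i.2 < 0) ->
    [/\ psitt k t i = 0, psitb k t i = 0, psibt k t i = 0 & psibb k t i = 0]
  }.

(* Main.v *)
(* Along one axis put lam = exp(i kappa h) and let v(n) = eta(n) lam^n, so that
   the definition of eta reads
     2 (lam v(n) - v(n+1)) = i (sigma_n / omega) (1 - lam) (v(n) + v(n+1)).
   Hence, with
     psi(n) = c (i / (2 omega h)) (1 - lam) (v(n) + v(n+1)),
   c = lam^(k-1) for the tilde variable and c = lam^(-k) for the bar variable,
   h sigma_n psi(n) = c (lam v(n) - v(n+1)), and all the sums over translates in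
   the auxiliary equations and in (P0) telescope.  In (P0) the sums of the
   damped variables become the defects lam^k v(n) - v(n+k) and
   lam^(-k) v(n) - v(n-k); the corner variables are products of such functions
   in the two directions, and
     lam1^k1 lam2^k2 v1 v2 = (v1' + D1) (v2' + D2)
   (v' the translate, D the defect): v1' v2' gives L_h u and the terms with a D
   give the remaining sums of (P0).  So the right-hand side of (P0) is the symbol
   of L_h at kappa times u, which is - omega^2 u by the discrete wave equation.  Grouping the lattice sum by
   quadrants uses that the coefficients are invariant under the symmetries of
   the square. *)

Require Import Defs.
From HB Require Import structures.
From mathcomp Require Import all_boot all_order all_algebra.
From mathcomp Require Import complex.
From mathcomp Require Import all_classical all_reals all_analysis.
From mathcomp Require Import measurable_realfun ring lra zify.
Import Order.TTheory GRing.Theory Num.Theory.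
Import numFieldNormedType.Exports.
Local Open Scope classical_set_scope.
Local Open Scope complex_scope.
Local Open Scope ring_scope.

Set Implicit Arguments.
Unset Strict Implicit.
Unset Printing Implicit Defensive.

(** * Symmetry and support of the coefficients *)

Lemma disc_sqr (R : realType) (delta : R) : 0 < delta ->
  disc delta = [set z : R * R | z.1 ^+ 2 + z.2 ^+ 2 <= delta ^+ 2].
Proof.
move=> d0; apply/funext=> z /=; congr is_true; rewrite /enorm.
by rewrite -[delta in LHS]gtr0_norm// -sqrtr_sqr ler_sqrt// sqr_ge0.
Qed.

Lemma measurable_disc (R : realType) (delta : R) :
  0 < delta -> measurable (disc delta).
Proof.
move=> d0; pose f (z : R * R) := z.1 ^+ 2 + z.2 ^+ 2.
have -> : disc delta = [set: R * R] `&` f @^-1` `]-oo, delta ^+ 2].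
  by rewrite disc_sqr// setTI; apply/seteqP; split=> z /=; rewrite in_itv.
suff mf : measurable_fun setT f by apply: mf.
by apply: measurable_funD; apply: measurable_funX.
Qed.

(* [leb2] lives on the product of two copies of [measurableTypeR R], whose
   display differs from the default one of [R * R]. *)
Notation mR2 R := (measurableTypeR R * measurableTypeR R)%type.

(** Uniqueness of the product measure: a measure that agrees with it on measurable rectangles is
    equal to it. *)
Lemma leb2_pushforward (R : realType) (f : mR2 R -> mR2 R) :
  measurable_fun setT f ->
  (forall A B : set (measurableTypeR R), measurable A -> measurable B ->
    leb2 R (f @^-1` (A `*` B)) = (lebesgue_measure A * lebesgue_measure B)%E) ->
  forall A : set (mR2 R), measurable A -> leb2 R A = pushforward (leb2 R) f A.
Proof.
move=> mf fE A mA.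
have uniq_m := @product_measure_unique _ _ _ _ R lebesgue_measure lebesgue_measure
  (measure_function_pushforward__canonical__measure_function_Measure (leb2 R) mf).
exact: uniq_m.
Qed.

(** Change of variables under a measure-preserving map. The disc is its own preimage because [f]
    preserves [enorm], and nonnegativity of [g] gives the pushforward formula. *)
Lemma integral_disc_invariant (R : realType) (delta : R)
    (f : mR2 R -> mR2 R) (g : mR2 R -> R) :
  0 < delta -> measurable_fun setT f ->
  (forall A B : set (measurableTypeR R), measurable A -> measurable B ->
    leb2 R (f @^-1` (A `*` B)) = (lebesgue_measure A * lebesgue_measure B)%E) ->
  (forall z : R * R, enorm (f z : R * R) = enorm z) ->
  measurable_fun (disc delta) g -> (forall z, 0 <= g z) ->
  \int[leb2 R]_(z in disc delta) g (f z) = \int[leb2 R]_(z in disc delta) g z.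
Proof.
move=> d0 mf fE fn mg g0; rewrite /Rintegral; congr fine.
transitivity (\int[pushforward (leb2 R) f]_(z in disc delta) (g z)%:E)%E; last first.
  apply: eq_measure_integral => A mA _.
  by symmetry; exact: leb2_pushforward.
rewrite ge0_integral_pushforward//.
- congr (integral _ _ _); apply/seteqP.
  by split=> z; rewrite /disc/preimage/= fn.
- exact: measurable_disc.
- exact/measurable_EFinP.
- by move=> z _; rewrite lee_fin.
Qed.

(** [flip] and [exch] generate the symmetry group of the square, so invariance under these two
    yields all symmetries of the coefficients. *)
Definition flip (R : realType) (z : mR2 R) : mR2 R := (- z.1, z.2).
Definition exch (R : realType) (z : mR2 R) : mR2 R := (z.2, z.1).

Lemma measurable_flip (R : realType) : measurable_fun setT (@flip R).
Proof.
apply: measurable_fun_pair => //.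
by apply: (measurableT_comp (@oppr_measurable R setT)).
Qed.

Lemma leb2_flip (R : realType) (A B : set (measurableTypeR R)) :
  measurable A -> measurable B ->
  leb2 R (@flip R @^-1` (A `*` B)) = (lebesgue_measure A * lebesgue_measure B)%E.
Proof.
move=> mA mB; rewrite -[lebesgue_measure A]lebesgue_measureN//.
have mNA : measurable (-%R @^-1` A : set (measurableTypeR R)).
  by rewrite -[X in measurable X]setTI; exact: oppr_measurable.
by rewrite /pushforward -(product_measure1E lebesgue_measure lebesgue_measure mNA mB).
Qed.

Lemma measurable_exch (R : realType) : measurable_fun setT (@exch R).
Proof. exact: measurable_fun_pair. Qed.

Lemma leb2_exch (R : realType) (A B : set (measurableTypeR R)) :
  measurable A -> measurable B ->
  leb2 R (@exch R @^-1` (A `*` B)) = (lebesgue_measure A * lebesgue_measure B)%E.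
Proof.
move=> mA mB.
rewrite muleC -(product_measure1E lebesgue_measure lebesgue_measure mB mA).
by congr (leb2 R _); apply/seteqP; split=> z [].
Qed.

Lemma enorm_flip (R : realType) (z : R * R) : enorm (flip z) = enorm z.
Proof. by rewrite /enorm /= sqrrN. Qed.

Lemma enorm_exch (R : realType) (z : R * R) : enorm (exch z) = enorm z.
Proof. by rewrite /enorm /= addrC. Qed.

Lemma weight_flip (R : realType) (z : R * R) : weight (flip z) = weight z.
Proof. by rewrite /weight enorm_flip normrN. Qed.

Lemma weight_exch (R : realType) (z : R * R) : weight (exch z) = weight z.
Proof. by rewrite /weight enorm_exch addrC. Qed.

Lemma hatN (R : realType) (h : R) (n : int) (x : R) :
  hat h (- n) x = hat h n (- x).
Proof.
by rewrite /hat mulNr -opprD normrN mulrNz opprK.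
Qed.

Lemma coef_integrand_ge0 (R : realType) (h : R) (gamma : R -> R)
    (k : lattice) (z : R * R) :
  (forall r : R, 0 <= r -> 0 <= gamma r) -> 0 <= coef_integrand h gamma k z.
Proof.
move=> g0; rewrite /coef_integrand !mulr_ge0 ?g0 ?sqrtr_ge0 ?le_max ?lexx//.
Qed.

Section CoefSymmetry.
Context (R : realType) (h delta : R) (gamma : R -> R).
Hypothesis delta_gt0 : 0 < delta.
Hypothesis gamma_ge0 : forall r : R, 0 <= r -> 0 <= gamma r.
Hypothesis coef_integrable : forall k : lattice, k != (0, 0) ->
  (leb2 R).-integrable (disc delta)
    (fun z => (coef_integrand h gamma k z)%:E).

Let measurable_coef_integrand (k : lattice) : k != (0, 0) ->
  measurable_fun (disc delta) (coef_integrand h gamma k).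
Proof.
by move=> k0; apply/measurable_EFinP; exact: measurable_int (coef_integrable k0).
Qed.

(** Substituting [flip z] for [z] in the integral moves the sign from the node to the argument of
    the hat function; the weight and the radial kernel do not change. *)
Lemma coef_flip (a b : int) :
  coef h delta gamma (- a, b) = coef h delta gamma (a, b).
Proof.
rewrite /coef {1}xpair_eqE oppr_eq0 -[_ && _]xpair_eqE; case: ifPn => // ab0; rewrite /coef_offdiag.
congr (_^-1 * _); first by rewrite -weight_flip /grid /flip/= -mulrN mulrNz opprK.
rewrite -(integral_disc_invariant delta_gt0 (@measurable_flip R) (@leb2_flip R)
  (@enorm_flip R) (measurable_coef_integrand ab0))//; last first.
  by move=> z; exact: coef_integrand_ge0.
apply: eq_Rintegral => z _.
by rewrite /coef_integrand weight_flip enorm_flip /phi/= hatN.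
Qed.

Lemma coef_exch (a b : int) :
  coef h delta gamma (b, a) = coef h delta gamma (a, b).
Proof.
rewrite /coef {1}xpair_eqE andbC -[_ && _]xpair_eqE; case: ifPn => // ab0; rewrite /coef_offdiag.
congr (_^-1 * _); first by rewrite -weight_exch.
rewrite -(integral_disc_invariant delta_gt0 (@measurable_exch R) (@leb2_exch R)
  (@enorm_exch R) (measurable_coef_integrand ab0))//; last first.
  by move=> z; exact: coef_integrand_ge0.
apply: eq_Rintegral => z _.
by rewrite /coef_integrand weight_exch enorm_exch /phi/= [hat _ b _ * _]mulrC.
Qed.

End CoefSymmetry.

Lemma le_enorm (R : realType) (z : R * R) :
  `|z.1| <= enorm z /\ `|z.2| <= enorm z.
Proof.
by rewrite -!sqrtr_sqr /enorm; split; rewrite ler_sqrt ?addr_ge0 ?sqr_ge0//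
  ?lerDl ?lerDr sqr_ge0.
Qed.

Lemma hat_eq0 (R : realType) (h delta : R) (n : int) (x : R) : 0 < h ->
  delta / h + 1 <= `|n|%:~R -> `|x| <= delta -> hat h n x = 0.
Proof.
move=> h0 hn hx; rewrite /hat; apply/max_idPl; rewrite subr_le0.
have : `|x / h| <= delta / h.
  by rewrite normrM (gtr0_norm (x := h^-1)) ?invr_gt0// ler_pM2r ?invr_gt0.
have := ler_normB (x / h) (x / h - n%:~R); rewrite opprB addrC subrK.
rewrite -intr_norm; lra.
Qed.

(** A hat function of half-width [h] centred at distance at least [delta + h] from an axis vanishes
    on the disc. This makes the lattice sums genuinely finite, whereas a finitely supported sum
    defaults to 0 when infinitely many terms are nonzero. *)
Lemma coef_finite_support (R : realType) (h delta : R) (gamma : R -> R) :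
  0 < h -> 0 < delta ->
  exists N : nat, forall k : lattice,
    (N < `|k.1|)%N || (N < `|k.2|)%N -> coef h delta gamma k = 0.
Proof.
move=> h0 d0; exists (Num.truncn (delta / h + 1)).+1 => k hk.
have big (n : int) : ((Num.truncn (delta / h + 1)).+1 < `|n|)%N ->
    delta / h + 1 <= `|n|%:~R.
  move=> hn; apply: (le_trans (ltW (truncnS_gt _))).
  by rewrite -abszE -pmulrn ler_nat ltnW.
have k0 : k != (0, 0).
  by apply/negP => /eqP kE; move: hk; rewrite kE.
rewrite /coef (negPf k0) /coef_offdiag.
rewrite (_ : \int[_]_(_ in _) _ = 0) ?mulr0//.
under eq_Rintegral => z.
  rewrite inE /disc/= => hz; have [z1 z2] := @le_enorm R z.
  have -> : coef_integrand h gamma k z = 0.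
    rewrite /coef_integrand /phi; case/orP: hk => /big hk.
      by rewrite (hat_eq0 h0 hk (le_trans z1 hz)) !mul0r.
    by rewrite (hat_eq0 h0 hk (le_trans z2 hz)) mulr0 !mul0r.
  over.
by rewrite /Rintegral integral0.
Qed.

(** * Telescoping sums *)

Section Telescoping.
Context (F : fieldType) (lam : F) (v : int -> F).
Hypothesis lam_neq0 : lam != 0.

(** Measures how far [v] is from being geometric with ratio [lam]. For the damped mode it is, up to
    the factor [c / h], the damped auxiliary variable. *)
Definition gap (n : int) : F := lam * v n - v (n + 1).

Let gapt (k l : nat) (n : int) : (l < k)%N ->
  lam ^+ (k - l).-1 * gap n = lam ^+ (k - l) * v n - lam ^+ (k - l.+1) * v (n + 1).
Proof. by move=> lk; rewrite /gap -subnS -[(k - l)%N]prednK ?subn_gt0// -subnS exprS; ring. Qed.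

Let gapb (k l : nat) (n : int) : (l < k)%N ->
  lam ^- (k - l) * gap n = lam ^- (k - l.+1) * v n - lam ^- (k - l) * v (n + 1).
Proof.
move=> lk; rewrite /gap -[(k - l)%N]prednK ?subn_gt0// -subnS exprS.
by field; rewrite expf_neq0// lam_neq0.
Qed.

(** By [gapt] each summand is an increment of [f], so only the end terms [l = k] and [l = 0] remain.
    These are the forward sums over translates in (P0). *)
Lemma sum_gap_tilde (k : nat) (n : int) :
  \sum_(0 <= l < k) lam ^+ (k - l).-1 * gap (n + l%:Z) = lam ^+ k * v n - v (n + k%:Z).
Proof.
pose f l := - (lam ^+ (k - l) * v (n + l%:Z)).
rewrite (eq_big_nat _ _ (F2 := fun l => f l.+1 - f l)) => [|l /andP[_ lk]].
  by rewrite telescope_sumr// /f subnn subn0 addr0 expr0; ring.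
by rewrite gapt// /f -addn1 PoszD addrA; ring.
Qed.

Lemma sum_gap_bar (k : nat) (n : int) :
  \sum_(0 <= l < k) lam ^- (k - l) * gap (n + (- l%:Z - 1)) = v (n - k%:Z) - lam ^- k * v n.
Proof.
pose f l := lam ^- (k - l) * v (n - l%:Z).
rewrite (eq_big_nat _ _ (F2 := fun l => f l.+1 - f l)) => [|l /andP[_ lk]].
  by rewrite telescope_sumr// /f subnn subn0 subr0 expr0 invr1; ring.
rewrite gapb// /f; congr (_ * v _ - _ * v _); lia.
Qed.

Lemma sum_gap (k : nat) (n : int) :
  \sum_(0 <= l < k) (lam ^+ (k - l).-1 * gap (n + l%:Z)
                     - lam ^- (k - l) * gap (n + (- l%:Z - 1))) =
  (lam ^+ k * v n - v (n + k%:Z)) + (lam ^- k * v n - v (n - k%:Z)).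
Proof. by rewrite sumrB sum_gap_tilde sum_gap_bar opprB. Qed.

(** This is the right-hand side of (P1) multiplied by [2h], with each damped unknown written as a
    gap. The end term [f k] of the telescoping sum cancels the difference of [v]; in [f 1] the value
    [v (n + 2)] cancels against the two gaps in front. *)
Lemma rhs_tilde_gap (k : nat) (n : int) : (0 < k)%N ->
  v (n + (k%:Z - 1)) - v (n + (k%:Z + 1))
  - (lam ^+ k.-1 * gap (n + 1) + lam ^+ k.-1 * gap n)
  - \sum_(1 <= l < k) (lam ^+ (k - l).-1 * gap (n + (l%:Z + 1))
                       - lam ^+ (k - l).-1 * gap (n + (l%:Z - 1))) =
  lam ^+ k.-1 * (1 - lam) * (v n + v (n + 1)).
Proof.
move=> k0.
pose f l := lam ^+ (k - l) * (v (n + (l%:Z - 1)) - v (n + (l%:Z + 1))).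
rewrite (eq_big_nat _ _ (F2 := fun l => f l.+1 - f l)) => [|l /andP[_ lk]].
  rewrite telescope_sumr// /f subnn expr0 subn1 subrr addr0 /gap.
  have -> : n + 1 + 1 = n + (1%:Z + 1) by lia.
  ring.
rewrite !gapt// /f.
have -> : n + (l%:Z + 1) + 1 = n + (l.+1%:Z + 1) by lia.
have -> : n + (l%:Z - 1) + 1 = n + (l.+1%:Z - 1) by lia.
ring.
Qed.

Lemma rhs_bar_gap (k : nat) (n : int) : (0 < k)%N ->
  v (n + (- k%:Z)) - v (n + (- k%:Z + 2))
  - (lam ^- k * gap n + lam ^- k * gap (n + (- 1)))
  - \sum_(1 <= l < k) (lam ^- (k - l) * gap (n + (- l%:Z - 1))
                       - lam ^- (k - l) * gap (n + (- l%:Z + 1))) =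
  lam ^- k * (1 - lam) * (v n + v (n + 1)).
Proof.
move=> k0.
pose f l := lam ^- (k - l) * (v (n - l%:Z) - v (n + (- l%:Z + 2))).
rewrite (eq_big_nat _ _ (F2 := fun l => f l.+1 - f l)) => [|l /andP[_ lk]].
  rewrite telescope_sumr// /f subnn expr0 invr1 subn1 /gap.
  have -> : n + (- 1) + 1 = n by lia.
  have -> : n + (- 1%:Z + 2) = n + 1 by lia.
  (* The lower end term [f 1] carries the power [k - 1]; this brings it to the common factor
     [lam ^- k]. *)
  have -> : lam ^- k.-1 = lam * lam ^- k.
    by rewrite -[in RHS](prednK k0) exprS invfM mulVKf.
  ring.
rewrite !gapb// /f.
have -> : n + (- l%:Z - 1) + 1 = n - l%:Z by lia.
have -> : n + (- l%:Z + 1) + 1 = n + (- l%:Z + 2) by lia.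
have -> : n + (- l%:Z - 1) = n - l.+1%:Z by lia.
have -> : n + (- l%:Z + 1) = n + (- l.+1%:Z + 2) by lia.
ring.
Qed.

End Telescoping.

(** * The complex exponential and derivatives in time *)

Lemma cexpD (R : realType) (x y : R[i]) : cexp (x + y) = cexp x * cexp y.
Proof.
case: x y => [a b] [c d]; rewrite /cexp /= expRD cosD sinD; simpc.
by congr (_ +i* _); ring.
Qed.

Lemma cexp0 (R : realType) : cexp 0 = 1 :> R[i].
Proof. by rewrite /cexp /= expR0 cos0 sin0 mul1r. Qed.

Lemma cexpNM (R : realType) (x : R[i]) : cexp (- x) * cexp x = 1.
Proof. by rewrite -cexpD addNr cexp0. Qed.

Lemma cexp_neq0 (R : realType) (x : R[i]) : cexp x != 0.
Proof.
by apply/eqP => x0; have /eqP := cexpNM x; rewrite x0 mulr0 eq_sym oner_eq0.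
Qed.

Lemma cexpN (R : realType) (x : R[i]) : cexp (- x) = (cexp x)^-1.
Proof. by rewrite -[RHS]mul1r -(cexpNM x) mulfK// cexp_neq0. Qed.

Lemma cexpMz (R : realType) (x : R[i]) (n : int) : cexp (x * n%:~R) = cexp x ^ n.
Proof.
have cexpMn (m : nat) : cexp (x * m%:R) = cexp x ^+ m.
  elim: m => [|m IH]; first by rewrite mulr0 cexp0.
  by rewrite -natr1 mulrDr mulr1 cexpD IH exprSr.
case: n => m; first exact: cexpMn.
by rewrite NegzE mulrNz mulrN cexpN cexpMn exprnN.
Qed.

Lemma has_dt_cexp (R : realType) (omega : R) (c : R[i]) :
  has_dt (fun t => cexp (- 'i%C * omega%:C * t%:C) * c)
    (fun t => - 'i%C * omega%:C * (cexp (- 'i%C * omega%:C * t%:C) * c)).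
Proof.
case: c => a b.
have cE (t : R) : cexp (- 'i%C * omega%:C * t%:C) =
    cos (omega * t) +i* (- sin (omega * t)).
  rewrite /cexp; simpc; rewrite expR0 cosN sinN; simpc; by [].
move=> t; split; under eq_fun do rewrite cE; rewrite cE; simpc => /=.
  apply: is_derive_eq; rewrite /GRing.scale/=; ring.
apply: is_derive_eq; rewrite /GRing.scale/=; ring.
Qed.

(** Serves to turn the assumed wave equation into an algebraic identity, by comparison with the
    explicit derivative. *)
Lemma has_dt_unique (R : realType) (f f1 f2 : R -> R[i]) :
  has_dt f f1 -> has_dt f f2 -> f1 = f2.
Proof.
move=> d1 d2; apply/funext => t.
have [[r1 i1] [r2 i2]] := (d1 t, d2 t).
apply/eqP; rewrite eq_complex.
by rewrite -(@derive_val _ _ _ _ _ _ _ r1) -(@derive_val _ _ _ _ _ _ _ i1)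
  -(@derive_val _ _ _ _ _ _ _ r2) -(@derive_val _ _ _ _ _ _ _ i2) !eqxx.
Qed.

(** * Finite lattice sums *)

Lemma fsbig_over_seq (V : nmodType) (T : choiceType) (D : set T) (r : seq T) (F : T -> V) :
  uniq r -> (forall x, x \in r -> D x) ->
  (forall x, D x -> x \notin r -> F x = 0) ->
  \sum_(x \in D) F x = \sum_(x <- r) F x.
Proof.
move=> r_uniq rD F0; rewrite (fsbigE r)// big_seq_cond [RHS]big_seq.
by apply: eq_bigl => x; case: (boolP (x \in r)) => //= /rD Dx; rewrite mem_set.
Qed.

Lemma posN_sum (V : nmodType) (N : nat) (F : nat -> V) :
  (forall n, (N < n)%N -> F n = 0) ->
  \sum_(n \in posN) F n = \sum_(1 <= n < N.+1) F n.
Proof.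
move=> F0; apply: fsbig_over_seq; first exact: iota_uniq.
- by move=> n; rewrite mem_index_iota => /andP[].
- by move=> n /= n0; rewrite mem_index_iota n0/= ltnS -ltnNge => /F0.
Qed.

Lemma uniq_pairs (S T : choiceType) (s : seq S) (t : seq T) :
  uniq s -> uniq t -> uniq [seq (x, y) | x <- s, y <- t].
Proof. by move=> us ut; apply: allpairs_uniq => // -[? ?] [? ?] _ _ []/= -> ->. Qed.

Lemma mem_pairs (S T : choiceType) (s : seq S) (t : seq T) (p : S * T) :
  (p \in [seq (x, y) | x <- s, y <- t]) = (p.1 \in s) && (p.2 \in t).
Proof.
apply/allpairsP/andP => [[q [qs qt ->]]//|[ps pt]].
by exists p; split => //; case: p ps pt.
Qed.

Lemma posN2_sum (V : nmodType) (N : nat) (F : nat * nat -> V) :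
  (forall k, (N < k.1)%N || (N < k.2)%N -> F k = 0) ->
  \sum_(k \in posN2) F k = \sum_(1 <= m < N.+1) \sum_(1 <= n < N.+1) F (m, n).
Proof.
move=> F0; pose r := index_iota 1 N.+1.
rewrite (@fsbig_over_seq _ _ _ [seq (m, n) | m <- r, n <- r]).
- by rewrite big_allpairs.
- by rewrite uniq_pairs ?iota_uniq.
- move=> k; rewrite mem_pairs !mem_index_iota /posN2/=.
  by move=> /andP[/andP[-> _] /andP[-> _]].
- move=> k /= /andP[k1 k2]; rewrite mem_pairs !mem_index_iota k1 k2 !ltnS/=.
  by rewrite negb_and -!ltnNge; exact: F0.
Qed.

(** The integers from [-N] to [N], listed by sign so that a sum over them splits at once into the
    origin and pairs of opposite indices. *)
Definition int_range (N : nat) : seq int :=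
  0 :: [seq n%:Z | n <- index_iota 1 N.+1] ++ [seq - n%:Z | n <- index_iota 1 N.+1].

Lemma mem_int_range (N : nat) (n : int) : (n \in int_range N) = (`|n| <= N)%N.
Proof.
rewrite inE mem_cat; apply/idP/idP.
  by case/or3P => [/eqP->//|/mapP[m]|/mapP[m]]; rewrite mem_index_iota => + ->; lia.
case: n => [[//|n]|n] nN; apply/or3P; [apply: Or32|apply: Or33]; apply/mapP;
  exists n.+1; rewrite ?mem_index_iota//; lia.
Qed.

Lemma uniq_int_range (N : nat) : uniq (int_range N).
Proof.
rewrite /= mem_cat cat_uniq !map_inj_uniq ?iota_uniq/= ?andbT; last 2 first.
- by move=> m n []; lia.
- by move=> m n; lia.
apply/andP; split.
  by apply/negP => /orP[] /mapP[n]; rewrite mem_index_iota; lia.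
apply/hasPn => _ /mapP[n nN ->]; apply/negP => /mapP[m].
by move: nN; rewrite !mem_index_iota; lia.
Qed.

Lemma big_int_range (V : nmodType) (N : nat) (F : int -> V) :
  \sum_(n <- int_range N) F n = F 0 + \sum_(1 <= n < N.+1) (F n%:Z + F (- n%:Z)).
Proof. by rewrite big_cons big_cat !big_map big_split. Qed.

(** The grouping into origin, half-axes and open quadrants mirrors the index sets of the sums in
    (P0). *)
Lemma lattice_sum (V : nmodType) (N : nat) (F : lattice -> V) :
  (forall k : lattice, (N < `|k.1|)%N || (N < `|k.2|)%N -> F k = 0) ->
  \sum_(k \in [set: lattice]) F k =
  F (0, 0) + \sum_(1 <= n < N.+1)
    (F (n%:Z, 0) + F (- n%:Z, 0) + (F (0, n%:Z) + F (0, - n%:Z)))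
  + \sum_(1 <= m < N.+1) \sum_(1 <= n < N.+1)
    (F (m%:Z, n%:Z) + F (m%:Z, - n%:Z) + (F (- m%:Z, n%:Z) + F (- m%:Z, - n%:Z))).
Proof.
move=> F0; pose r := [seq (m, n) | m <- int_range N, n <- int_range N].
rewrite (@fsbig_over_seq _ _ _ r)//; last 2 first.
- by rewrite uniq_pairs ?uniq_int_range.
- by move=> k _; rewrite mem_pairs !mem_int_range negb_and -!ltnNge; exact: F0.
rewrite big_allpairs big_int_range big_int_range.
(* The row of index 0 has given the origin and the vertical half-axes; each pair of opposite rows
   now gives two points of the horizontal half-axes and the quadrant terms. *)
under [in X in _ + X = _]eq_bigr do rewrite !big_int_range addrACA -big_split.
rewrite [X in _ + X = _]big_split/= [in RHS]big_split/= [LHS]addrA; congr (_ + _).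
by rewrite -!addrA; congr (_ + _); rewrite addrC.
Qed.

(** * Separated solutions of the PML equations *)

Lemma big_axes (T : Type) (idx : T) (op : Monoid.law idx) (F : 'I_2 -> T) :
  \big[op/idx]_(al < 2) F al = op (F ax1) (F ax2).
Proof.
rewrite big_ord_recl big_ord1; congr (op _ (F _)).
exact: val_inj.
Qed.

Lemma axes_ind (P : 'I_2 -> Prop) : P ax1 -> P ax2 -> forall al, P al.
Proof.
move=> P1 P2 [[|[|//]] al2]; [move: P1|move: P2];
  by congr P; apply: val_inj.
Qed.

Definition other (al : 'I_2) : 'I_2 := if al == ax1 then ax2 else ax1.

Lemma axcoord_translate (al : 'I_2) (n : int) (i : lattice) :
  axcoord (translate al n i) al = axcoord i al + n.
Proof. by elim/axes_ind: al. Qed.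

Lemma axcoord_other_translate (al : 'I_2) (n : int) (i : lattice) :
  axcoord (translate (other al) n i) al = axcoord i al.
Proof. by elim/axes_ind: al. Qed.

Lemma axcoord_translate_other (al : 'I_2) (n : int) (i : lattice) :
  axcoord (translate al n i) (other al) = axcoord i (other al).
Proof. by elim/axes_ind: al. Qed.

Lemma eta_le0 (R : realType) (h : R) (n : int) (s : int -> R) (kap : R[i]) (omega : R) :
  n <= 0 -> Defs.eta h n s kap omega = 1.
Proof. by case: n => [[|n]|n] //= _; rewrite big_geq. Qed.

Definition phase (R : realType) (omega t : R) : R[i] :=
  cexp (- 'i%C * omega%:C * t%:C).

Lemma has_dt_ext (R : realType) (f g f' g' : R -> R[i]) :
  f =1 g -> f' =1 g' -> has_dt f f' -> has_dt g g'.
Proof. by move=> /funext -> /funext ->. Qed.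

(** Every unknown is time-harmonic, so each evolution equation reduces to an algebraic identity at
    fixed time. *)
Lemma has_dt_phase (R : realType) (omega : R) (c : R[i]) (f f' : R -> R[i]) :
  (forall t, f t = phase omega t * c) ->
  (forall t, f' t = - 'i%C * omega%:C * f t) -> has_dt f f'.
Proof.
move=> fE f'E; apply: (has_dt_ext _ _ (has_dt_cexp omega c)) => t.
  by rewrite fE.
by rewrite f'E fE.
Qed.

Lemma has_dtt_phase (R : realType) (omega : R) (c : R[i]) (f f'' : R -> R[i]) :
  (forall t, f t = phase omega t * c) ->
  (forall t, f'' t = - (omega ^+ 2)%:C * f t) -> has_dtt f f''.
Proof.
move=> fE f''E; exists (fun t => - 'i%C * omega%:C * f t).
  exact: has_dt_phase.
apply: (@has_dt_phase _ omega (- 'i%C * omega%:C * c)) => t; first by rewrite fE mulrCA.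
rewrite f''E mulrA; congr (_ * _).
by rewrite mulrACA mulrNN -expr2 sqr_i mulN1r -expr2 rmorphXn.
Qed.

(** Contribution of the half-axes: [x], [xp], [xm] are the values of one mode at a point and its two
    translates, [y], [yp], [ym] those of the other. Translates plus defects give [(lx + lx') * x]
    and [(ly + ly') * y]. *)
Lemma edge_identity (F : comNzRingType) (a p x xp xm y yp ym lx lx' ly ly' : F) :
  a * (p * (xp * y)) + a * (p * (xm * y)) + (a * (p * (x * yp)) + a * (p * (x * ym)))
  + a * (p * (y * (lx * x - xp + (lx' * x - xm))))
  + a * (p * (x * (ly * y - yp + (ly' * y - ym)))) =
  (a * (lx * 1) + a * (lx' * 1) + (a * (1 * ly) + a * (1 * ly'))) * (p * (x * y)).
Proof. ring. Qed.

(** Contribution of the quadrants: the left side expands the product of (translates plus defect)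
    along the two axes, and each factor collapses as in [edge_identity]. *)
Lemma corner_identity (F : comNzRingType) (a p x xp xm y yp ym lx lx' ly ly' : F) :
  a * (p * (xp * yp)) + a * (p * (xp * ym)) + (a * (p * (xm * yp)) + a * (p * (xm * ym)))
  + a * (p * ((ym + yp) * (lx * x - xp + (lx' * x - xm))))
  + a * (p * ((xm + xp) * (ly * y - yp + (ly' * y - ym))))
  + a * (p * ((lx * x - xp + (lx' * x - xm)) * (ly * y - yp + (ly' * y - ym)))) =
  (a * (lx * ly) + a * (lx * ly') + (a * (lx' * ly) + a * (lx' * ly'))) * (p * (x * y)).
Proof. ring. Qed.

Section PmlModes.
Context (R : realType) (h : R) (sigma : 'I_2 -> int -> R) (omega : R)
  (kappa : 'I_2 -> R[i]).
Hypothesis h_gt0 : 0 < h.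
Hypothesis sigma_lt0 : forall (al : 'I_2) (l : int), l < 0 -> sigma al l = 0.
Hypothesis omega_neq0 : omega != 0.
Hypothesis eta_wd : forall (al : 'I_2) (l : nat),
  eta_den h omega (sigma al l%:Z) (kappa al) != 0.

Definition lam (al : 'I_2) : R[i] := cexp ('i%C * kappa al * h%:C).

Definition mode (al : 'I_2) (n : int) : R[i] :=
  Defs.eta h n (sigma al) (kappa al) omega * lam al ^ n.

(* The cut-off below 0 is harmless in the equations since sigma vanishes there. *)
Definition aux (al : 'I_2) (c : R[i]) (n : int) : R[i] :=
  if n < 0 then 0 else
  c * ('i%C / omega%:C / (2 * h%:C) * (1 - lam al) * (mode al n + mode al (n + 1))).

Lemma lam_neq0 (al : 'I_2) : lam al != 0.
Proof. exact: cexp_neq0. Qed.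

Lemma hC_neq0 : h%:C != 0 :> R[i].
Proof. by rewrite fmorph_eq0 gt_eqF. Qed.

Lemma omegaC_neq0 : omega%:C != 0 :> R[i].
Proof. by rewrite fmorph_eq0. Qed.

Lemma traveling_waveE (t : R) (i : lattice) :
  traveling_wave h omega kappa t i = phase omega t * (lam ax1 ^ i.1 * lam ax2 ^ i.2).
Proof.
rewrite /traveling_wave big_axes /=.
by rewrite -!cexpMz /lam; congr (_ * (cexp _ * cexp _)); ring.
Qed.

Lemma pml_waveE (t : R) (i : lattice) :
  pml_wave h omega sigma kappa t i = phase omega t * (mode ax1 i.1 * mode ax2 i.2).
Proof.
rewrite /pml_wave big_axes /= /mode.
by rewrite -!cexpMz /lam; congr (_ * (_ * cexp _ * (_ * cexp _))); ring.
Qed.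

Lemma mode_rec (al : 'I_2) (n : int) :
  mode al (n + 1) * eta_den h omega (sigma al n) (kappa al) =
  lam al * mode al n * eta_num h omega (sigma al n) (kappa al).
Proof.
rewrite /mode expfzDr ?lam_neq0// expr1z.
case: n => n.
  have -> : n%:Z + 1 = n.+1 by lia.
  rewrite /Defs.eta big_nat_recr//=; field; exact: eta_wd.
(* For negative [n] the value of eta is 1 at [n] and also at [n + 1], which is at most 0; the
   damping vanishes, so numerator and denominator are both 2. *)
rewrite !eta_le0; [|lia..]; rewrite sigma_lt0 ?ltrNz0// /eta_den /eta_num mul0r.
by rewrite !mulr0 !mul0r !addr0 !mul1r [lam al * _]mulrC.
Qed.

(** The recursion solved for the gap: since [lam * (1 - lam^-1) = - (1 - lam)], the damping terms of
    numerator and denominator combine into one multiple of [mode al n + mode al (n + 1)]. *)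
Lemma gap_mode (al : 'I_2) (n : int) :
  gap (lam al) (mode al) n =
  (sigma al n)%:C * ('i%C / omega%:C / 2 * (1 - lam al) * (mode al n + mode al (n + 1))).
Proof.
have := mode_rec al n; rewrite /eta_den /eta_num !mulNr cexpN -/(lam al) fmorph_div /gap.
move: (mode al n) (mode al (n + 1)) => x y xy_rec.
have xy : y * (2 + 'i%C * ((sigma al n)%:C / omega%:C) * (1 - lam al)) =
    lam al * x * (2 + 'i%C * ((sigma al n)%:C / omega%:C) * (1 - (lam al)^-1)).
  exact: xy_rec.
have two : 2 != 0 :> R[i] by rewrite pnatr_eq0.
apply: (mulfI two).
have -> : 2 * (lam al * x - y) = (lam al * x * 2 - y * 2) by ring.
have -> : y * 2 = lam al * x * (2 + 'i%C * ((sigma al n)%:C / omega%:C) * (1 - (lam al)^-1))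
  - y * ('i%C * ((sigma al n)%:C / omega%:C) * (1 - lam al)).
  by rewrite -xy; ring.
by field; rewrite omegaC_neq0 lam_neq0.
Qed.

(** Valid at every integer: below 0 the left side is cut off, and the gap is 0 because the damping
    is. *)
Lemma damp_aux (al : 'I_2) (c : R[i]) (n : int) :
  (sigma al n)%:C * aux al c n = c * gap (lam al) (mode al) n / h%:C.
Proof.
rewrite gap_mode /aux; case: ifPn => [n0|_]; first by rewrite sigma_lt0//; ring.
have two : 2 != 0 :> R[i] by rewrite pnatr_eq0.
by field; rewrite omegaC_neq0 hC_neq0.
Qed.

(** * Auxiliary equations for unknowns separated along one axis *)

Section Separated.
Variables (al : 'I_2) (k : nat) (w : gridfun R) (psi : nat -> gridfun R).
Variables (a : gridfun R) (c : nat -> R[i]) (i : lattice).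
Hypothesis a_inv : forall n, a (translate al n i) = a i.
Hypothesis psiE : forall m j, (0 < m)%N -> psi m j = a j * aux al (c m) (axcoord j al).

Lemma tau_damp (m : nat) (n : int) : (0 < m)%N ->
  tau al n (damp sigma al (psi m)) i =
  a i / h%:C * (c m * gap (lam al) (mode al) (axcoord i al + n)).
Proof.
move=> m0; rewrite /tau /damp psiE// axcoord_translate a_inv mulrCA damp_aux.
ring.
Qed.

Hypothesis k_gt0 : (0 < k)%N.
Hypothesis i_ge0 : 0 <= axcoord i al.
Hypothesis wE : forall j, w j = a j * mode al (axcoord j al).

Let tau_w (n : int) : tau al n w i = a i * mode al (axcoord i al + n).
Proof. by rewrite /tau wE a_inv axcoord_translate. Qed.

(** The prefactor ['i / omega] of [aux] cancels the time derivative factor, leaving the closed form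
    reached by the telescoped right-hand sides. Nonnegativity of the coordinate excludes the
    cut-off. *)
Let dt_psi : - 'i%C * omega%:C * psi k i =
  a i / (2 * h%:C) *
  (c k * (1 - lam al) * (mode al (axcoord i al) + mode al (axcoord i al + 1))).
Proof.
rewrite psiE// /aux ltNge i_ge0/=.
have -> : forall x : R[i], - 'i%C * omega%:C * (a i * (c k * ('i%C / omega%:C / (2 * h%:C)
    * (1 - lam al) * x))) = - ('i%C * 'i%C) * (omega%:C / omega%:C) *
    (a i / (2 * h%:C) * (c k * (1 - lam al) * x)) by move=> x; ring.
by rewrite -expr2 sqr_i opprK divff ?omegaC_neq0// !mul1r.
Qed.

(** The amplitude [a] holds the phase and the dependence on the other axis. It is constant along
    [al], hence factors out and leaves [rhs_tilde_gap]. With a mode inside [a] this gives (P1), with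
    [aux] inside [a] it gives (P3) and (P5). *)
Lemma rhs_tilde_separated : (forall m, c m = lam al ^+ m.-1) ->
  rhs_tilde h sigma al k w psi i = - 'i%C * omega%:C * psi k i.
Proof.
move=> cE; rewrite dt_psi cE -rhs_tilde_gap ?lam_neq0// /rhs_tilde !tau_w !tau_damp// addr0 cE.
have -> : \sum_(1 <= l < k)
      (tau al (l%:Z + 1) (damp sigma al (psi (k - l)%N)) i
       - tau al (l%:Z - 1) (damp sigma al (psi (k - l)%N)) i) / 2 =
  a i / (2 * h%:C) * \sum_(1 <= l < k)
    (lam al ^+ (k - l).-1 * gap (lam al) (mode al) (axcoord i al + (l%:Z + 1))
     - lam al ^+ (k - l).-1 * gap (lam al) (mode al) (axcoord i al + (l%:Z - 1))).
  rewrite big_distrr/=; apply: eq_big_nat => l /andP[_ lk].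
  by rewrite !tau_damp ?subn_gt0// cE invfM; ring.
by rewrite invfM; ring.
Qed.

Lemma rhs_bar_separated : (forall m, c m = lam al ^- m) ->
  rhs_bar h sigma al k w psi i = - 'i%C * omega%:C * psi k i.
Proof.
move=> cE; rewrite dt_psi cE -rhs_bar_gap ?lam_neq0// /rhs_bar !tau_w !tau_damp// addr0 cE.
have -> : \sum_(1 <= l < k)
      (tau al (- l%:Z - 1) (damp sigma al (psi (k - l)%N)) i
       - tau al (- l%:Z + 1) (damp sigma al (psi (k - l)%N)) i) / 2 =
  a i / (2 * h%:C) * \sum_(1 <= l < k)
    (lam al ^- (k - l) * gap (lam al) (mode al) (axcoord i al + (- l%:Z - 1))
     - lam al ^- (k - l) * gap (lam al) (mode al) (axcoord i al + (- l%:Z + 1))).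
  rewrite big_distrr/=; apply: eq_big_nat => l /andP[_ lk].
  by rewrite !tau_damp ?subn_gt0// cE invfM; ring.
by rewrite invfM; ring.
Qed.

End Separated.

(** The scalar [c] encodes both the accent and the upper index: [lam ^+ k.-1] for a tilde,
    [lam ^- k] for a bar. *)
Definition psi_edge (al : 'I_2) (c : R[i]) (t : R) : gridfun R := fun i =>
  phase omega t * (aux al c (axcoord i al) * mode (other al) (axcoord i (other al))).

Definition psi_corner (c1 c2 : R[i]) (t : R) : gridfun R := fun i =>
  phase omega t * (aux ax1 c1 i.1 * aux ax2 c2 i.2).

(** Forward and backward defects at distance [k] are added, since (P0) involves them only through
    their sum. *)
Definition defect (al : 'I_2) (k : nat) (n : int) : R[i] :=
  lam al ^ k%:Z * mode al n - mode al (n + k%:Z)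
  + (lam al ^ (- k%:Z) * mode al n - mode al (n - k%:Z)).

Lemma defect_sum (al : 'I_2) (k : nat) (n : int) :
  defect al k n = \sum_(0 <= l < k)
    (lam al ^+ (k - l).-1 * gap (lam al) (mode al) (n + l%:Z)
     - lam al ^- (k - l) * gap (lam al) (mode al) (n + (- l%:Z - 1))).
Proof. by rewrite sum_gap ?lam_neq0// /defect exprnP exprnN. Qed.

Lemma sum_layer (al : 'I_2) (k : nat) (t : R) (i : lattice) :
  h%:C * \sum_(0 <= l < k)
    layer sigma al (fun m => psi_edge al (lam al ^+ m.-1) t)
      (fun m => psi_edge al (lam al ^- m) t) k l i =
  phase omega t * (mode (other al) (axcoord i (other al)) * defect al k (axcoord i al)).
Proof.
have edge_damp d n : tau al n (damp sigma al (psi_edge al d t)) i =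
    phase omega t * mode (other al) (axcoord i (other al)) / h%:C *
      (d * gap (lam al) (mode al) (axcoord i al + n)).
  (* The family is taken constant in its upper index, so the positive index 1 stands for all of
     them. *)
  rewrite (@tau_damp al (fun=> psi_edge al d t)
    (fun j => phase omega t * mode (other al) (axcoord j (other al))) (fun=> d) _ _ _ 1)//.
    by move=> ?; rewrite axcoord_translate_other.
  by move=> ? j _; rewrite /psi_edge mulrCA mulrC -mulrA mulrCA mulrA.
rewrite mulrA defect_sum !big_distrr/=; apply: eq_big_nat => l /andP[_ lk].
rewrite /layer /= !edge_damp.
move: (gap _ _ _) (gap _ _ _) (mode _ _) => g1 g2 v.
by field; rewrite hC_neq0 ?expf_neq0 ?lam_neq0.
Qed.

Lemma sum_layer_other (al : 'I_2) (k : nat) (n : int) (t : R) (i : lattice) :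
  h%:C * \sum_(0 <= l < k)
    tau (other al) n (layer sigma al (fun m => psi_edge al (lam al ^+ m.-1) t)
      (fun m => psi_edge al (lam al ^- m) t) k l) i =
  phase omega t * (mode (other al) (axcoord i (other al) + n) * defect al k (axcoord i al)).
Proof. by rewrite sum_layer axcoord_translate axcoord_other_translate. Qed.

Lemma damp12_corner (c1 c2 : R[i]) (t : R) (a b : int) (i : lattice) :
  tau ax1 a (tau ax2 b (damp12 sigma (psi_corner c1 c2 t))) i =
  phase omega t / h%:C ^+ 2 * ((c1 * gap (lam ax1) (mode ax1) (i.1 + a)) *
    (c2 * gap (lam ax2) (mode ax2) (i.2 + b))).
Proof.
rewrite /tau /damp12 /psi_corner /= [LHS]mulrCA [X in _ * X = _]mulrACA !damp_aux.
move: (gap _ _ _) (gap _ _ _) (phase omega t) => g1 g2 p.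
by field; exact: hC_neq0.
Qed.

(** The four signed terms are the expansion of (tilde minus bar) along axis 1 times (tilde minus
    bar) along axis 2, so the double sum factors into two single-axis sums. The factor [h ^+ 2]
    cancels one [1 / h] from each damped factor. *)
Lemma sum_corner (k1 k2 : nat) (t : R) (i : lattice) :
  h%:C ^+ 2 * \sum_(0 <= l < k1) \sum_(0 <= m < k2)
    (let a := (k1 - l)%N in let b := (k2 - m)%N in
     tau ax1 l%:Z (tau ax2 m%:Z (damp12 sigma
       (psi_corner (lam ax1 ^+ a.-1) (lam ax2 ^+ b.-1) t))) i
     - tau ax1 (- l%:Z - 1) (tau ax2 m%:Z (damp12 sigma
       (psi_corner (lam ax1 ^- a) (lam ax2 ^+ b.-1) t))) i
     - tau ax1 l%:Z (tau ax2 (- m%:Z - 1) (damp12 sigma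
       (psi_corner (lam ax1 ^+ a.-1) (lam ax2 ^- b) t))) i
     + tau ax1 (- l%:Z - 1) (tau ax2 (- m%:Z - 1) (damp12 sigma
       (psi_corner (lam ax1 ^- a) (lam ax2 ^- b) t))) i) =
  phase omega t * (defect ax1 k1 i.1 * defect ax2 k2 i.2).
Proof.
rewrite !defect_sum big_distrlr/= !big_distrr/=; apply: eq_bigr => l _.
rewrite !big_distrr/=; apply: eq_bigr => m _; rewrite !damp12_corner.
move: (gap _ _ _) (gap _ _ _) (gap _ _ _) (gap _ _ _) (phase omega t) => g1 g2 g3 g4 p.
by field; rewrite hC_neq0 ?expf_neq0 ?lam_neq0.
Qed.

Lemma pml_wave_other (al : 'I_2) (t : R) (i : lattice) :
  pml_wave h omega sigma kappa t i =
  phase omega t * mode (other al) (axcoord i (other al)) * mode al (axcoord i al).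
Proof.
rewrite pml_waveE -mulrA; congr (_ * _); elim/axes_ind: al.
  exact: mulrC.
by [].
Qed.

Lemma edge_tilde_eq (al : 'I_2) (k : nat) (i : lattice) :
  (0 < k)%N -> 0 <= axcoord i al ->
  has_dt (fun t => psi_edge al (lam al ^+ k.-1) t i)
    (fun t => rhs_tilde h sigma al k (pml_wave h omega sigma kappa t)
      (fun m => psi_edge al (lam al ^+ m.-1) t) i).
Proof.
move=> k0 i0; apply: has_dt_phase => t; first by [].
apply: (@rhs_tilde_separated _ _ _ (fun m => psi_edge al (lam al ^+ m.-1) t)
  (fun j => phase omega t * mode (other al) (axcoord j (other al)))
  (fun m => lam al ^+ m.-1)) => //.
- by move=> n; rewrite axcoord_translate_other.
- by move=> m j _; rewrite /psi_edge mulrCA mulrC.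
- by move=> j; exact: pml_wave_other.
Qed.

Lemma edge_bar_eq (al : 'I_2) (k : nat) (i : lattice) :
  (0 < k)%N -> 0 <= axcoord i al ->
  has_dt (fun t => psi_edge al (lam al ^- k) t i)
    (fun t => rhs_bar h sigma al k (pml_wave h omega sigma kappa t)
      (fun m => psi_edge al (lam al ^- m) t) i).
Proof.
move=> k0 i0; apply: has_dt_phase => t; first by [].
apply: (@rhs_bar_separated _ _ _ (fun m => psi_edge al (lam al ^- m) t)
  (fun j => phase omega t * mode (other al) (axcoord j (other al)))
  (fun m => lam al ^- m)) => //.
- by move=> n; rewrite axcoord_translate_other.
- by move=> m j _; rewrite /psi_edge mulrCA mulrC.
- by move=> j; exact: pml_wave_other.
Qed.

(** The weight [c] along axis 2 is arbitrary, so both (P3) and (P5) follow; [corner_bar_eq] likewise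
    covers (P4) and (P6). *)
Lemma corner_tilde_eq (c : R[i]) (k : nat) (i : lattice) :
  (0 < k)%N -> 0 <= i.1 ->
  has_dt (fun t => psi_corner (lam ax1 ^+ k.-1) c t i)
    (fun t => rhs_tilde h sigma ax1 k (psi_edge ax2 c t)
      (fun m => psi_corner (lam ax1 ^+ m.-1) c t) i).
Proof.
move=> k0 i0; apply: has_dt_phase => t; first by [].
apply: (@rhs_tilde_separated _ _ _ (fun m => psi_corner (lam ax1 ^+ m.-1) c t)
  (fun j => phase omega t * aux ax2 c j.2) (fun m => lam ax1 ^+ m.-1)) => //.
- by move=> m j _; rewrite /psi_corner mulrCA mulrC.
- by move=> j; rewrite /psi_edge mulrA.
Qed.

Lemma corner_bar_eq (c : R[i]) (k : nat) (i : lattice) :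
  (0 < k)%N -> 0 <= i.1 ->
  has_dt (fun t => psi_corner (lam ax1 ^- k) c t i)
    (fun t => rhs_bar h sigma ax1 k (psi_edge ax2 c t)
      (fun m => psi_corner (lam ax1 ^- m) c t) i).
Proof.
move=> k0 i0; apply: has_dt_phase => t; first by [].
apply: (@rhs_bar_separated _ _ _ (fun m => psi_corner (lam ax1 ^- m) c t)
  (fun j => phase omega t * aux ax2 c j.2) (fun m => lam ax1 ^- m)) => //.
- by move=> m j _; rewrite /psi_corner mulrCA mulrC.
- by move=> j; rewrite /psi_edge mulrA.
Qed.

Lemma psi_edge_eq0 (al : 'I_2) (c : R[i]) (t : R) (i : lattice) :
  axcoord i al < 0 -> psi_edge al c t i = 0.
Proof. by move=> i0; rewrite /psi_edge /aux i0 mul0r mulr0. Qed.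

Lemma psi_corner_eq0 (c1 c2 : R[i]) (t : R) (i : lattice) :
  (i.1 < 0) || (i.2 < 0) -> psi_corner c1 c2 t i = 0.
Proof.
by rewrite /psi_corner /aux => /orP[] ->; rewrite ?mul0r mulr0 ?mulr0.
Qed.

(** * Evaluation of the right-hand side of (P0) *)

Section Assembly.
Context (delta : R) (gamma : R -> R) (N : nat) (t : R) (i : lattice).
Hypothesis coef0 : forall k : lattice,
  (N < `|k.1|)%N || (N < `|k.2|)%N -> coef h delta gamma k = 0.

Local Notation a k := (coef h delta gamma k)%:C.
Local Notation psit := (fun al k => psi_edge al (lam al ^+ k.-1) t).
Local Notation psib := (fun al k => psi_edge al (lam al ^- k) t).

Let aC0 k (x : R[i]) : (N < `|k.1|)%N || (N < `|k.2|)%N -> a k * x = 0.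
Proof. by move=> /coef0 ->; rewrite mul0r. Qed.

Lemma edge_sum (al : 'I_2) :
  h%:C * (\sum_(k \in posN) \sum_(0 <= l < k)
    a (k%:Z, 0) * layer sigma al (psit al) (psib al) k l i) =
  \sum_(1 <= m < N.+1) a (m%:Z, 0) *
    (phase omega t * (mode (other al) (axcoord i (other al)) * defect al m (axcoord i al))).
Proof.
rewrite (@posN_sum _ N) => [|n nN]; last by apply: big1_seq => l _; rewrite aC0 ?nN.
by rewrite big_distrr; apply: eq_bigr => m _; rewrite -big_distrr /= mulrCA sum_layer.
Qed.

Lemma edge_sums :
  h%:C * (\sum_(al < 2) \sum_(k \in posN) \sum_(0 <= l < k)
    a (k%:Z, 0) * layer sigma al (psit al) (psib al) k l i) =
  \sum_(1 <= m < N.+1)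
    a (m%:Z, 0) * (phase omega t * (mode ax2 i.2 * defect ax1 m i.1)) +
  \sum_(1 <= m < N.+1)
    a (m%:Z, 0) * (phase omega t * (mode ax1 i.1 * defect ax2 m i.2)).
Proof.
by rewrite big_axes mulrDr; congr (_ + _); [exact: (edge_sum ax1)|exact: (edge_sum ax2)].
Qed.

(** A shift along the other axis acts only on the undamped mode of [psi_edge], so the layers still
    sum to the same defect along [al]. *)
Lemma mixed_sum (al : 'I_2) :
  h%:C * (\sum_(k \in posN2) \sum_(0 <= l < axcoord k al)
    a (k.1%:Z, k.2%:Z) *
      (tau (other al) (- (axcoord k (other al))%:Z)
         (layer sigma al (psit al) (psib al) (axcoord k al) l) i
       + tau (other al) (axcoord k (other al))%:Z
         (layer sigma al (psit al) (psib al) (axcoord k al) l) i)) =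
  \sum_(1 <= m < N.+1) \sum_(1 <= n < N.+1) a (m%:Z, n%:Z) *
    (phase omega t * ((mode (other al) (axcoord i (other al) - (axcoord (m, n) (other al))%:Z)
      + mode (other al) (axcoord i (other al) + (axcoord (m, n) (other al))%:Z))
      * defect al (axcoord (m, n) al) (axcoord i al))).
Proof.
rewrite (@posN2_sum _ N) => [|k kN]; last by apply: big1_seq => l _; rewrite aC0.
rewrite big_distrr; apply: eq_bigr => m _; rewrite big_distrr; apply: eq_bigr => n _.
rewrite -big_distrr /= mulrCA big_split /= mulrDr !sum_layer_other.
by rewrite mulrDl -mulrDr.
Qed.

Lemma mixed_sums :
  h%:C * (\sum_(al < 2) \sum_(be < 2 | al != be)
    \sum_(k \in posN2) \sum_(0 <= l < axcoord k al)
    a (k.1%:Z, k.2%:Z) *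
      (tau be (- (axcoord k be)%:Z)
         (layer sigma al (psit al) (psib al) (axcoord k al) l) i
       + tau be (axcoord k be)%:Z
         (layer sigma al (psit al) (psib al) (axcoord k al) l) i)) =
  \sum_(1 <= m < N.+1) \sum_(1 <= n < N.+1) a (m%:Z, n%:Z) *
    (phase omega t * ((mode ax2 (i.2 - n%:Z) + mode ax2 (i.2 + n%:Z)) * defect ax1 m i.1)) +
  \sum_(1 <= m < N.+1) \sum_(1 <= n < N.+1) a (m%:Z, n%:Z) *
    (phase omega t * ((mode ax1 (i.1 - m%:Z) + mode ax1 (i.1 + m%:Z)) * defect ax2 n i.2)).
Proof.
rewrite big_axes mulrDr.
by congr (_ + _); rewrite big_mkcond big_axes /= ?add0r ?addr0;
  [exact: (mixed_sum ax1)|exact: (mixed_sum ax2)].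
Qed.

Lemma corner_sum :
  h%:C ^+ 2 * (\sum_(k \in posN2) \sum_(0 <= l < k.1) \sum_(0 <= m < k.2)
    a (k.1%:Z, k.2%:Z) *
      (let kk := ((k.1 - l)%N, (k.2 - m)%N) in
       tau ax1 l%:Z (tau ax2 m%:Z (damp12 sigma
         (psi_corner (lam ax1 ^+ kk.1.-1) (lam ax2 ^+ kk.2.-1) t))) i
       - tau ax1 (- l%:Z - 1) (tau ax2 m%:Z (damp12 sigma
         (psi_corner (lam ax1 ^- kk.1) (lam ax2 ^+ kk.2.-1) t))) i
       - tau ax1 l%:Z (tau ax2 (- m%:Z - 1) (damp12 sigma
         (psi_corner (lam ax1 ^+ kk.1.-1) (lam ax2 ^- kk.2) t))) i
       + tau ax1 (- l%:Z - 1) (tau ax2 (- m%:Z - 1) (damp12 sigma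
         (psi_corner (lam ax1 ^- kk.1) (lam ax2 ^- kk.2) t))) i)) =
  \sum_(1 <= m < N.+1) \sum_(1 <= n < N.+1)
    a (m%:Z, n%:Z) * (phase omega t * (defect ax1 m i.1 * defect ax2 n i.2)).
Proof.
rewrite (@posN2_sum _ N) => [|k kN]; last first.
  by apply: big1_seq => l _; apply: big1_seq => m _; rewrite aC0.
rewrite big_distrr; apply: eq_bigr => m _; rewrite big_distrr; apply: eq_bigr => n _.
rewrite -sum_corner mulrCA; congr (_ * _); rewrite big_distrr; apply: eq_bigr => l _.
by rewrite big_distrr.
Qed.

Lemma rhs_wave_pml :
  (forall m n : int, coef h delta gamma (- m, n) = coef h delta gamma (m, n)) ->
  (forall m n : int, coef h delta gamma (n, m) = coef h delta gamma (m, n)) ->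
  rhs_wave h delta gamma sigma (pml_wave h omega sigma kappa t) psit psib
    (fun k => psi_corner (lam ax1 ^+ k.1.-1) (lam ax2 ^+ k.2.-1) t)
    (fun k => psi_corner (lam ax1 ^- k.1) (lam ax2 ^+ k.2.-1) t)
    (fun k => psi_corner (lam ax1 ^+ k.1.-1) (lam ax2 ^- k.2) t)
    (fun k => psi_corner (lam ax1 ^- k.1) (lam ax2 ^- k.2) t) i =
  (\sum_(k \in [set: lattice]) a k * (lam ax1 ^ k.1 * lam ax2 ^ k.2)) *
  pml_wave h omega sigma kappa t i.
Proof.
move=> coefN coefC.
have coefNr (m n : int) : coef h delta gamma (m, - n) = coef h delta gamma (m, n).
  by rewrite (coefC (- n) m) coefN coefC.
rewrite /rhs_wave /nonlocal_op corner_sum mixed_sums edge_sums.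
rewrite (@lattice_sum _ N) => [|k /aC0//]; rewrite (@lattice_sum _ N) => [|k /aC0//].
rewrite mulrDl [in RHS]mulrDl.
(* Pairs the half-axes with the two edge sums, and the quadrants with the two mixed sums and the
   corner sum, so that the two polynomial identities apply term by term. *)
have assoc (x y z e e' m m' c : R[i]) :
  x + y + z + (e + e') + (m + m') + c = x + (y + e + e') + (z + m + m' + c) by ring.
rewrite assoc; congr (_ + _ + _).
- by rewrite /= !pml_waveE /= !addr0 !expr0z !mulr1.
- rewrite -!big_split big_distrl/=; apply: eq_bigr => m _.
  rewrite !pml_waveE /= !addr0 !expr0z (coefC m%:Z 0) (coefC (- m%:Z) 0) !coefN /defect.
  exact: (edge_identity (a (m%:Z, 0)) (phase omega t)
    (mode ax1 i.1) (mode ax1 (i.1 + m%:Z)) (mode ax1 (i.1 - m%:Z))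
    (mode ax2 i.2) (mode ax2 (i.2 + m%:Z)) (mode ax2 (i.2 - m%:Z))
    (lam ax1 ^ m%:Z) (lam ax1 ^ (- m%:Z)) (lam ax2 ^ m%:Z) (lam ax2 ^ (- m%:Z))).
- rewrite -!big_split big_distrl/=; apply: eq_bigr => m _.
  rewrite -!big_split big_distrl/=; apply: eq_bigr => n _.
  rewrite !pml_waveE /= !coefN !coefNr /defect.
  exact: (corner_identity (a (m%:Z, n%:Z)) (phase omega t)
    (mode ax1 i.1) (mode ax1 (i.1 + m%:Z)) (mode ax1 (i.1 - m%:Z))
    (mode ax2 i.2) (mode ax2 (i.2 + n%:Z)) (mode ax2 (i.2 - n%:Z))
    (lam ax1 ^ m%:Z) (lam ax1 ^ (- m%:Z)) (lam ax2 ^ n%:Z) (lam ax2 ^ (- n%:Z))).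
Qed.

End Assembly.

End PmlModes.

(** * The dispersion relation and the conclusion *)

Lemma has_dtt_unique (R : realType) (f f1 f2 : R -> R[i]) :
  has_dtt f f1 -> has_dtt f f2 -> f1 = f2.
Proof.
move=> [g1 fg1 g1f1] [g2 fg2 g2f2].
by apply: has_dt_unique g1f1 _; rewrite (has_dt_unique fg1 fg2).
Qed.

(** At the origin and at time 0 the traveling wave equals 1, so the discrete operator returns its
    symbol there, while two explicit time derivatives give [- omega ^+ 2]. *)
Lemma dispersion (R : realType) (h delta : R) (gamma : R -> R) (omega : R)
    (kappa : 'I_2 -> R[i]) :
  (forall i : lattice,
      has_dtt (fun t => traveling_wave h omega kappa t i)
        (fun t => nonlocal_op h delta gamma
          (traveling_wave h omega kappa t) i)) ->
  \sum_(k \in [set: lattice]) (coef h delta gamma k)%:C *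
    (lam h kappa ax1 ^ k.1 * lam h kappa ax2 ^ k.2) = - (omega ^+ 2)%:C.
Proof.
move=> /(_ (0, 0)) wave0.
have wave0' : has_dtt (fun t => traveling_wave h omega kappa t (0, 0))
    (fun t => - (omega ^+ 2)%:C * traveling_wave h omega kappa t (0, 0)).
  by apply: has_dtt_phase => t //; rewrite traveling_waveE.
have /(congr1 (fun f => f 0)) := has_dtt_unique wave0 wave0'.
have phase0 : phase omega 0 = 1 :> R[i] by rewrite /phase mulr0 cexp0.
rewrite traveling_waveE phase0 !expr0z !mulr1 => <-.
by apply: eq_fsbigr => k _; rewrite traveling_waveE phase0 mul1r !add0r.
Qed.

Unset Implicit Arguments.

Theorem theorem3p1 (R : realType) (h delta : R) (gamma : R -> R)
    (sigma : 'I_2 -> int -> R) (omega : R) (kappa : 'I_2 -> R[i])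
    (h_gt0 : 0 < h) (delta_gt0 : 0 < delta)
    (gamma_ge0 : forall r : R, 0 <= r -> 0 <= gamma r)
    (coef_integrable : forall k : lattice, k != (0, 0) ->
      (leb2 R).-integrable (disc delta)
        (fun z => (coef_integrand h gamma k z)%:E))
    (sigma_ge0 : forall (al : 'I_2) (l : int), 0 <= sigma al l)
    (sigma_lt0 : forall (al : 'I_2) (l : int), l < 0 -> sigma al l = 0)
    (omega_neq0 : omega != 0)
    (kappa_K : forall al : 'I_2, in_K h (kappa al))
    (eta_wd : forall (al : 'I_2) (l : nat),
      eta_den h omega (sigma al l%:Z) (kappa al) != 0)
    (wave_eq : forall i : lattice,
      has_dtt (fun t => traveling_wave h omega kappa t i)
        (fun t => nonlocal_op h delta gamma
          (traveling_wave h omega kappa t) i)) :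
  exists (psit psib : 'I_2 -> nat -> R -> gridfun R)
    (psitt psitb psibt psibb : nat * nat -> R -> gridfun R),
    pml_solution h delta gamma sigma (pml_wave h omega sigma kappa)
      psit psib psitt psitb psibt psibb.
Proof.
pose L := lam h kappa.
pose edge := psi_edge h sigma omega kappa.
pose corner := psi_corner h sigma omega kappa.
(* A tilde along an axis contributes the weight [L ^+ k.-1], a bar the weight [L ^- k]. In the
   corner variables the lower accent belongs to axis 1 and the upper one to axis 2. *)
exists (fun al k => edge al (L al ^+ k.-1)), (fun al k => edge al (L al ^- k)),
  (fun k => corner (L ax1 ^+ k.1.-1) (L ax2 ^+ k.2.-1)),
  (fun k => corner (L ax1 ^- k.1) (L ax2 ^+ k.2.-1)),
  (fun k => corner (L ax1 ^+ k.1.-1) (L ax2 ^- k.2)),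
  (fun k => corner (L ax1 ^- k.1) (L ax2 ^- k.2)).
split.
- move=> i _; apply: has_dtt_phase => t; first exact: pml_waveE.
  have [N coef0] := coef_finite_support gamma h_gt0 delta_gt0.
  have coefN := coef_flip delta_gt0 gamma_ge0 coef_integrable.
  have coefC := coef_exch delta_gt0 gamma_ge0 coef_integrable.
  (* The factor [- omega ^+ 2] from the second time derivative becomes the symbol of the discrete
     operator, which is what the right-hand side of (P0) evaluates to. *)
  rewrite -(dispersion wave_eq).
  exact: (rhs_wave_pml h_gt0 sigma_lt0 omega_neq0 eta_wd _ _ coef0 coefN coefC).
- exact: edge_tilde_eq.
- exact: edge_bar_eq.
- by move=> k i k1 _ i1 _; exact: corner_tilde_eq.
- by move=> k i k1 _ i1 _; exact: corner_bar_eq.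
- by move=> k i k1 _ i1 _; exact: corner_tilde_eq.
- by move=> k i k1 _ i1 _; exact: corner_bar_eq.
- by move=> al k t i _ i0; split; exact: psi_edge_eq0.
- by move=> k t i _ _ i0; split; exact: psi_corner_eq0.
Qed.
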